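(* Under the Sparse Triangle Hypothesis, with $\delta>0$ the constant from that hypothesis, any algorithm achieving approximation ratio better than $5/3$ for $n$-Pairs Minimum Distance in undirected graphs requires $m^{1+\delta-o(1)}$ time. Under the Dense Triangle Hypothesis, any algorithm achieving approximation ratio better than $5/3$ for $n$-Pairs Minimum Distance in undirected graphs requires $n^{\omega-o(1)}$ time.
   Context: $n$-Pairs Minimum Distance: given a graph with $n$ vertices, $m$ edges and $O(n)$ vertex pairs $(s_i,t_i)$, compute $\min_i d(s_i,t_i)$. Approximation ratio $\alpha$ means output $\hat x$ with $x\le\hat x\le\alpha x$. $\omega$ is the matrix multiplication exponent. Sparse Triangle Hypothesis: in the word-RAM model with $O(\log n)$-bit words, there exists a constant $\delta>0$ such that triangle detection in undirected $m$-edge graphs requires $m^{1+\delta-o(1)}$ time. Dense Triangle Hypothesis: in the same model, for any constant $\varepsilon>0$ there is no $O(n^{\omega-\varepsilon})$-time algorithm for triangle detection in undirected $n$-vertex graphs. *)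

(* Defs.v *)
(* MathComp + MathComp-Analysis. *)
From Stdlib Require PeanoNat.
From mathcomp Require Import all_boot all_order all_algebra.
From mathcomp Require Import classical_sets reals constructive_ereal ereal exp.

Set Implicit Arguments.
Unset Strict Implicit.
Unset Printing Implicit Defensive.

Import Order.TTheory GRing.Theory Num.Theory.

(* Word RAM with w-bit words: registers and memory cells hold integers below
   2 ^ w, arithmetic is modulo 2 ^ w, and a memory address is one word. *)

Inductive binop :=
  | Add | Sub | Mul | Div | Mod | And | Or | Xor | Shl | Shr | Less | Equal.

(* x / 0 = 0 and x mod 0 = x, as in ssrnat. *)
Definition eval_binop (w : nat) (o : binop) (x y : nat) : nat :=
  match o with
  | Add => (x + y) %% 2 ^ w
  | Sub => (x + (2 ^ w - y)) %% 2 ^ w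
  | Mul => (x * y) %% 2 ^ w
  | Div => x %/ y
  | Mod => x %% y
  | And => PeanoNat.Nat.land x y
  | Or => PeanoNat.Nat.lor x y
  | Xor => PeanoNat.Nat.lxor x y
  | Shl => (x * 2 ^ y) %% 2 ^ w
  | Shr => x %/ 2 ^ y
  | Less => nat_of_bool (x < y)
  | Equal => nat_of_bool (x == y)
  end.

(* Registers are named by naturals; a program mentions finitely many. *)
Inductive instr :=
  | Const (r c : nat)
  | Bin (o : binop) (r s t : nat)
  | Read (r s : nat)    (* r := memory[s] *)
  | Write (r s : nat)   (* memory[r] := s *)
  | Jz (r l : nat)      (* jump to instruction l if r = 0 *)
  | Halt.

Definition program := seq instr.

Record config := Config { pc : nat; reg : nat -> nat; mem : nat -> nat }.

Definition update (f : nat -> nat) (i v : nat) : nat -> nat :=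
  fun j => if j == i then v else f j.

(* The default [Halt] makes a program stop when control leaves its code. *)
Definition current (P : program) (c : config) : instr := nth Halt P (pc c).

Definition step (w : nat) (P : program) (c : config) : config :=
  match current P c with
  | Const r x => Config (pc c).+1 (update (reg c) r (x %% 2 ^ w)) (mem c)
  | Bin o r s t =>
      Config (pc c).+1
        (update (reg c) r (eval_binop w o (reg c s) (reg c t))) (mem c)
  | Read r s => Config (pc c).+1 (update (reg c) r (mem c (reg c s))) (mem c)
  | Write r s => Config (pc c).+1 (reg c) (update (mem c) (reg c r) (reg c s))
  | Jz r l => Config (if reg c r == 0 then l else (pc c).+1) (reg c) (mem c)
  | Halt => c
  end.

Definition halted (P : program) (c : config) : bool :=
  if current P c is Halt then true else false.

(* The input occupies memory cells 0, 1, 2, ...; everything else is zero. *)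
Definition initial (input : seq nat) : config :=
  Config 0 (fun=> 0) (nth 0 input).

Definition run (w : nat) (P : program) (input : seq nat) (t : nat) : config :=
  iter t (step w P) (initial input).

(* The input is addressable and each of its entries is a word. *)
Definition fits (w : nat) (input : seq nat) : bool :=
  (size input <= 2 ^ w) && all (fun v => v < 2 ^ w) input.

(* [nvert] is the number n of vertices, which determines the word length.
   [accepts x y z] says that final contents y and z of registers 0 and 1
   represent a correct output on instance x. *)
Record problem := Problem {
  instance : Type;
  nvert : instance -> nat;
  encode : instance -> seq nat;
  accepts : instance -> nat -> nat -> Prop
}.

(* Word length a * floor(log2 n) + b: words of O(log n) bits, for constants
   a and b chosen with the program. *)
Definition word_length (a b n : nat) : nat := a * trunc_log 2 n + b.

Definition solves_in (Q : problem) (P : program) (a b : nat)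
    (x : instance Q) (t : nat) : Prop :=
  let w := word_length a b (nvert x) in
  let c := run w P (encode x) t in
  [/\ fits w (encode x), halted P c & accepts x (reg c 0) (reg c 1)].

Section Complexity.
Variable R : realType.
Local Open Scope ring_scope.

(* A (deterministic) word-RAM algorithm that is correct on every instance and
   runs in time O(sz ^ e) on the instances in D. *)
Definition has_algorithm (Q : problem) (D : instance Q -> Prop)
    (sz : instance Q -> nat) (e : R) : Prop :=
  exists (P : program) (a b : nat),
    (forall x : instance Q, exists t : nat, solves_in P a b x t) /\
    exists (C : R) (N : nat), forall x : instance Q, D x -> (N <= sz x)%N ->
      exists2 t : nat, t%:R <= C * (sz x)%:R `^ e & solves_in P a b x t.

(* "Requires sz ^ (e - o(1)) time". *)
Definition requires_time (Q : problem) (D : instance Q -> Prop)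
    (sz : instance Q -> nat) (e : R) : Prop :=
  forall eps : R, 0 < eps -> ~ has_algorithm D sz (e - eps).

End Complexity.

(* A simple undirected graph given by a list containing each edge exactly
   once, in an arbitrary one of its two orientations. *)
Record graph := Graph {
  num_vertices : nat;
  edges : seq ('I_num_vertices * 'I_num_vertices);
  edges_loopless : all (fun e => e.1 != e.2) edges;
  edges_uniq : uniq [seq [set e.1; e.2] | e <- edges]
}.

Definition num_edges (G : graph) : nat := size (edges G).

Definition adj (G : graph) : rel 'I_(num_vertices G) :=
  fun u v => ((u, v) \in edges G) || ((v, u) \in edges G).

Definition no_isolated (G : graph) : Prop :=
  forall u : 'I_(num_vertices G), exists v : 'I_(num_vertices G), adj u v.

Definition flat_pairs (n : nat) (s : seq ('I_n * 'I_n)) : seq nat :=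
  flatten [seq [:: nat_of_ord e.1; nat_of_ord e.2] | e <- s].

Definition has_triangle (G : graph) : Prop :=
  exists u v w : 'I_(num_vertices G), [/\ adj u v, adj v w & adj w u].

(* Register 0 is nonzero exactly when there is a triangle. *)
Definition triangle_detection : problem :=
  @Problem graph num_vertices
    (fun G => [:: num_vertices G, num_edges G & flat_pairs (edges G)])
    (fun G y _ => y <> 0 <-> has_triangle G).

Section Distance.
Variable R : realType.
Local Open Scope classical_set_scope.
Local Open Scope ereal_scope.

(* The distance is +oo between distinct components. *)
Definition dist (G : graph) (s t : 'I_(num_vertices G)) : \bar R :=
  ereal_inf [set (size p)%:R%:E | p in
               [set p : seq 'I_(num_vertices G) |
                  path (@adj G) s p /\ last s p = t]].

Definition min_dist (G : graph)
    (ps : seq ('I_(num_vertices G) * 'I_(num_vertices G))) : \bar R :=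
  \big[Order.min/+oo]_(st <- ps) dist st.1 st.2.

(* Outputs are nonnegative rationals y / z, or +oo encoded by z = 0. *)
Definition output_value (y z : nat) : \bar R :=
  if z == 0%N then +oo else (y%:R / z%:R)%R%:E.

End Distance.

(* K is the constant in the O(n) bound on the number of pairs. *)
Record pairs_instance (K : nat) := PairsInstance {
  pgraph : graph;
  pairs : seq ('I_(num_vertices pgraph) * 'I_(num_vertices pgraph));
  pairs_bound : size pairs <= K * num_vertices pgraph
}.

Definition n_pairs_min_distance (R : realType) (K : nat) (alpha : R) :
    problem :=
  @Problem (pairs_instance K) (fun x => num_vertices (pgraph x))
    (fun x => [:: num_vertices (pgraph x), num_edges (pgraph x), size (pairs x)
                & flat_pairs (edges (pgraph x)) ++ flat_pairs (pairs x)])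
    (fun x y z => let d := min_dist R (pairs x) in
       (d <= output_value R y z)%E /\ (output_value R y z <= alpha%:E * d)%E).

(* Arithmetic straight-line programs over the rationals; operands are positions
   in the list of the inputs followed by the results computed so far. *)
Inductive arith :=
  | AConst (c : rat)
  | AAdd (i j : nat)
  | ASub (i j : nat)
  | AMul (i j : nat).

Section MatrixMultiplication.
Local Open Scope ring_scope.

Definition arith_step (vals : seq rat) (g : arith) : seq rat :=
  rcons vals
    match g with
    | AConst c => c
    | AAdd i j => vals`_i + vals`_j
    | ASub i j => vals`_i - vals`_j
    | AMul i j => vals`_i * vals`_j
    end.

Definition entries (n : nat) (A : 'M[rat]_n) : seq rat :=
  [seq A i j | i <- enum 'I_n, j <- enum 'I_n].

Definition computes_product (n : nat) (p : seq arith) : Prop :=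
  exists out : 'I_n -> 'I_n -> nat, forall (A B : 'M[rat]_n) (i j : 'I_n),
    (foldl arith_step (entries A ++ entries B) p)`_(out i j) = (A *m B) i j.

(* omega: the infimum of the exponents tau such that n x n matrices can be
   multiplied with O(n ^ tau) arithmetic operations. *)
Definition mm_exponent (R : realType) : R :=
  inf [set tau : R | exists C : R, forall n : nat, (0 < n)%N ->
        exists2 p : seq arith,
          (size p)%:R <= C * n%:R `^ tau & computes_product n p]%classic.

(* In the bounds depending on m only, graphs have no isolated vertices, so
   that n <= 2 m; otherwise m would not measure the size of the input. *)
Definition sparse_triangle_hypothesis (R : realType) (delta : R) : Prop :=
  0 < delta /\
  @requires_time R triangle_detection no_isolated num_edges (1 + delta).

Definition dense_triangle_hypothesis (R : realType) : Prop :=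
  forall eps : R, 0 < eps ->
    ~ @has_algorithm R triangle_detection (fun=> True) num_vertices
        (mm_exponent R - eps).

End MatrixMultiplication.

(* Main.v *)
Require Import Defs.
From mathcomp Require Import all_boot all_order all_algebra.
From mathcomp Require Import boolp reals constructive_ereal ereal exp.
From mathcomp Require Import zify lra.

(* A graph G on n vertices becomes a graph with four copies (layers) of the
   vertex set, an edge uv of G joining u and v in consecutive layers, and the
   query pairs join the copies of u in the first and last layers. Such a pair is
   at odd distance, equal to 3 exactly when u lies on a triangle, so that an
   output is smaller than 5 iff G has a triangle. The new graph has 4n vertices,
   and trunc_log 2 (4n) = trunc_log 2 n + 2, so that the constants a, b of the
   word length can be changed to make both machines use exactly the same words:
   a program for the distance problem is run unchanged after a prologue that
   rewrites its input in place in time O(n + m).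
   This overhead is absorbed by m ^ e if e >= 1 and by n ^ e if e >= 2. In the
   sparse case one may raise e to 1. In the dense case, if e < 2, an adversary
   argument shows that no hypothesis is needed: on a graph with n ^ 2 edges some
   edge is never read, and it could have been the query pair itself. *)

Set Implicit Arguments.
Unset Strict Implicit.
Unset Printing Implicit Defensive.

Import Order.TTheory GRing.Theory Num.Theory.

(** * Symbolic execution *)

(** The step count is bounded rather than exact, so that bounds add under composition and may be
    rounded up. *)
Definition reach (w : nat) (P : program) (T : nat) (c c' : config) : Prop :=
  exists2 t, t <= T & iter t (step w P) c = c'.

Lemma reach_refl w P T c : reach w P T c c.
Proof. by exists 0. Qed.

Lemma reach_trans w P T1 T2 c1 c2 c3 :
  reach w P T1 c1 c2 -> reach w P T2 c2 c3 -> reach w P (T1 + T2) c1 c3.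
Proof.
move=> [t1 le1 E1] [t2 le2 E2]; exists (t2 + t1).
  by rewrite addnC leq_add.
by rewrite iterD E1 E2.
Qed.

Lemma reach_le w P T T' c c' : T <= T' -> reach w P T c c' -> reach w P T' c c'.
Proof. by move=> leT [t let_ E]; exists t => //; apply: leq_trans leT. Qed.

Lemma reach_step w P T c c' :
  reach w P T (step w P c) c' -> reach w P T.+1 c c'.
Proof. by move=> [t let_ E]; exists t.+1 => //; rewrite iterSr. Qed.

(** Register files are kept in the form [nth 0 rs] for a concrete list [rs], on which updates reduce
    by computation. *)
Lemma update_nth (rs : seq nat) r v :
  update (nth 0 rs) r v = nth 0 (set_nth 0 rs r v).
Proof. by apply/funext => j; rewrite nth_set_nth. Qed.

Section SymbolicExecution.
Variables (w : nat) (P : program) (T pc : nat) (rs : seq nat).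
Variables (mm : nat -> nat) (c : config).

Local Notation rg r := (nth 0 rs r).
Local Notation next r v :=
  (reach w P T (Config pc.+1 (nth 0 (set_nth 0 rs r v)) mm) c).
Local Notation now := (reach w P T.+1 (Config pc (nth 0 rs) mm) c).

(** The side conditions of the arithmetic rules rule out wraparound, so that machine arithmetic
    modulo 2 ^ w becomes arithmetic on naturals. *)
Lemma reach_const r x :
  nth Halt P pc = Const r x -> x < 2 ^ w -> next r x -> now.
Proof.
move=> E lt H; apply: reach_step.
by rewrite /step /current /= E /= modn_small // update_nth.
Qed.

Lemma reach_add r s t : nth Halt P pc = Bin Add r s t ->
  rg s + rg t < 2 ^ w -> next r (rg s + rg t) -> now.
Proof.
move=> E lt H; apply: reach_step.
by rewrite /step /current /= E /= modn_small // update_nth.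
Qed.

Lemma reach_mul r s t : nth Halt P pc = Bin Mul r s t ->
  rg s * rg t < 2 ^ w -> next r (rg s * rg t) -> now.
Proof.
move=> E lt H; apply: reach_step.
by rewrite /step /current /= E /= modn_small // update_nth.
Qed.

Lemma reach_sub r s t : nth Halt P pc = Bin Defs.Sub r s t ->
  rg t <= rg s < 2 ^ w -> next r (rg s - rg t) -> now.
Proof.
move=> E /andP[le lt] H; apply: reach_step.
rewrite /step /current /= E /= update_nth.
have -> : rg s + (2 ^ w - rg t) = rg s - rg t + 2 ^ w by lia.
by rewrite modnDr modn_small //; lia.
Qed.

Lemma reach_read r s :
  nth Halt P pc = Read r s -> next r (mm (rg s)) -> now.
Proof.
by move=> E H; apply: reach_step; rewrite /step /current /= E /= update_nth.
Qed.

Lemma reach_write r s : nth Halt P pc = Write r s ->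
  reach w P T (Config pc.+1 (nth 0 rs) (update mm (rg r) (rg s))) c -> now.
Proof. by move=> E H; apply: reach_step; rewrite /step /current /= E. Qed.

Lemma reach_jump r l : nth Halt P pc = Jz r l -> rg r = 0 ->
  reach w P T (Config l (nth 0 rs) mm) c -> now.
Proof. by move=> E r0 H; apply: reach_step; rewrite /step /current /= E r0. Qed.

Lemma reach_nojump r l : nth Halt P pc = Jz r l -> 0 < rg r ->
  reach w P T (Config pc.+1 (nth 0 rs) mm) c -> now.
Proof.
move=> E r0 H; apply: reach_step; rewrite /step /current /= E.
by rewrite eqn0Ngt r0.
Qed.

End SymbolicExecution.

Ltac exec_side lem := apply: lem; [reflexivity | cbn [nth] | cbn [set_nth nth]].
Ltac exec lem := apply: lem; [reflexivity | cbn [set_nth nth]].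

(** * The prologue: rewriting the input in place *)

Fixpoint writes (mm : nat -> nat) (p : nat) (vs : seq nat) : nat -> nat :=
  if vs is v :: vs' then writes (update mm p v) p.+1 vs' else mm.

Lemma writesE mm p vs j :
  writes mm p vs j = if p <= j < p + size vs then nth 0 vs (j - p) else mm j.
Proof.
elim: vs mm p => [|v vs IH] mm p /=; first by case: ifP => //; lia.
rewrite IH /update; case: eqP => [->|ne].
  by rewrite ltnn leqnn subnn /= ifT //; lia.
have [lt|ge] := ltnP p j; last by rewrite ifF //; lia.
have -> : j - p = (j - p.+1).+1 by lia.
by rewrite addSnnS (ltnW lt).
Qed.

Lemma writes_cat mm p vs1 vs2 :
  writes mm p (vs1 ++ vs2) = writes (writes mm p vs1) (p + size vs1) vs2.
Proof.
by elim: vs1 mm p => [|v vs1 IH] mm p /=; rewrite ?addn0 // IH addSnnS.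
Qed.

(** Writes the two edges between a layer and the next that come from the edge in registers 5 and 6,
    then moves both endpoints one layer up; three copies in a row thus handle three layers. Register
    0 serves as the constant 0. *)
Definition layer_code : program :=
  [:: Bin Add 7 5 1; Bin Add 8 6 1;
      Write 4 5; Bin Add 4 4 3; Write 4 8; Bin Add 4 4 3;
      Write 4 6; Bin Add 4 4 3; Write 4 7; Bin Add 4 4 3;
      Bin Add 5 7 0; Bin Add 6 8 0].

(* Registers: 1 holds n; 2 the edge counter, from m down to 0; 3 the constant 1;
   4 an address; 5 the vertex counter, then with 6 the two endpoints of an edge;
   7 holds 3n and 8 the address of the first pair, until both become scratch.
   The block of edge i is written at 3 + 12 i, past the input edges
   0, ..., i - 1, hence the downward loop. The jumps to 17 and 26 close the
   loops on the pairs and on the edges. *)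
Definition prologue : program :=
  [:: Read 1 0; Jz 1 3; Jz 0 4; Halt;
      Const 3 1; Read 2 3;
      Const 4 4; Bin Mul 4 4 1; Write 0 4;
      Const 4 6; Bin Mul 4 4 2; Write 3 4;
      Bin Add 8 4 4; Const 4 3; Bin Add 8 8 4; Bin Mul 7 4 1; Bin Add 5 1 0;
      Jz 5 26; Bin Defs.Sub 5 5 3; Bin Add 4 5 5; Bin Add 4 4 8; Write 4 5;
      Bin Add 4 4 3; Bin Add 6 7 5; Write 4 6; Jz 0 17;
      Jz 2 75; Bin Defs.Sub 2 2 3; Bin Add 4 2 2; Const 6 2; Bin Add 4 4 6;
      Read 5 4; Bin Add 4 4 3; Read 6 4;
      Const 4 12; Bin Mul 4 4 2; Const 7 3; Bin Add 4 4 7]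
  ++ layer_code ++ layer_code ++ layer_code
  ++ [:: Jz 0 26;
      Const 4 2; Write 4 1; Const 1 0; Const 2 0; Const 3 0; Const 4 0;
      Const 5 0; Const 6 0; Const 7 0; Const 8 0].

Definition layer_cells (n u v : nat) : seq nat := [:: u; v + n; v; u + n].

Definition edge_cells (n : nat) (e : nat * nat) : seq nat :=
  layer_cells n e.1 e.2 ++ layer_cells n (e.1 + n) (e.2 + n)
  ++ layer_cells n (e.1 + n + n) (e.2 + n + n).

Definition triangle_input (n : nat) (E : seq (nat * nat)) : seq nat :=
  [:: n, size E & flatten [seq [:: e.1; e.2] | e <- E]].

(** The third header cell is the number of query pairs, one for each vertex. *)
Definition layered_input (n : nat) (E : seq (nat * nat)) : seq nat :=
  [:: 4 * n, 6 * size E, n & flatten [seq edge_cells n e | e <- E]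
     ++ flatten [seq [:: i; 3 * n + i] | i <- iota 0 n]].

Lemma size_flatten_map (S : Type) (f : S -> seq nat) k (s : seq S) :
  (forall x, size (f x) = k) -> size (flatten [seq f x | x <- s]) = size s * k.
Proof. by move=> fk; elim: s => //= x s IH; rewrite size_cat fk IH mulSn. Qed.

Lemma nth_flatten_map (S : Type) (x0 : S) (f : S -> seq nat) k (s : seq S) i j :
  (forall x, size (f x) = k) -> i < size s -> j < k ->
  nth 0 (flatten [seq f x | x <- s]) (i * k + j) = nth 0 (f (nth x0 s i)) j.
Proof.
move=> fk; elim: s i => //= x s IH [|i] lti ltj; rewrite nth_cat fk ?ltj //.
by rewrite mulSn -addnA ltnNge leq_addr /= addKn IH.
Qed.

Lemma size_layered_input n E :
  size (layered_input n E) = 3 + 12 * size E + 2 * n.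
Proof.
rewrite /= size_cat (@size_flatten_map _ _ 12) // (@size_flatten_map _ _ 2) //.
by rewrite size_iota; lia.
Qed.

Section Prologue.
Variables (w n : nat) (E : seq (nat * nat)) (Q : program).
Let m := size E.
Hypothesis n_gt0 : 0 < n.
Hypothesis fit_size : size (layered_input n E) <= 2 ^ w.
Hypothesis fit_vertices : 4 * n < 2 ^ w.
Hypothesis E_lt : forall e : nat * nat, e \in E -> (e.1 < n) && (e.2 < n).
Let P := prologue ++ Q.

Let fit : 3 + 12 * m + 2 * n <= 2 ^ w.
Proof. by rewrite -size_layered_input. Qed.

(** When n = 1 and m = 0 the input has only 5 cells; a power of two that is at least 5 is at least
    8, which makes room for the constant 6 of the prologue. *)
Let word8 : 8 <= 2 ^ w.
Proof.
have : 5 <= 2 ^ w by lia.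
by case: w => [|[|[|k]]] // _; rewrite !expnS; have := expn_gt0 2 k; lia.
Qed.

(** The copies of [layer_code] start at 38, 50 and 62. Enumerating them makes each program counter a
    numeral, so that instructions are fetched by computation. *)
Lemma reach_layer k i p u v x7 x8 mm :
  k \in [:: 38; 50; 62] -> p + 4 < 2 ^ w -> u + n < 2 ^ w -> v + n < 2 ^ w ->
  reach w P 12
    (Config k (nth 0 [:: 0; n; i; 1; p; u; v; x7; x8]) mm)
    (Config (k + 12)
       (nth 0 [:: 0; n; i; 1; p.+4; u + n; v + n; u + n; v + n])
       (writes mm p (layer_cells n u v))).
Proof.
rewrite !inE => Hk Hp Hu Hv; case/or3P: Hk => /eqP ->.
all: do 2![exec_side reach_add; first by lia].
all: do 4![exec reach_write; exec_side reach_add; first by lia].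
all: do 2![exec_side reach_add; first by lia].
all: by rewrite !addn0 !addn1; apply: reach_refl.
Qed.

Definition input_pairs := flatten [seq [:: i; 3 * n + i] | i <- iota 0 n].

Lemma nth_input_pairs i : i < n ->
  nth 0 input_pairs (2 * i) = i /\ nth 0 input_pairs (2 * i).+1 = 3 * n + i.
Proof.
move=> lti; have szi : i < size (iota 0 n) by rewrite size_iota.
rewrite mulnC -[i * 2]addn0 -[(_ + 0).+1]addnS.
by rewrite !(nth_flatten_map 0 (k := 2)) // nth_iota.
Qed.

(** The sum has the form in which the program computes it: 6 m added to itself, then 3. *)
Let base := 6 * m + 6 * m + 3.

(** The pairs can be written before any edge is processed, because the input ends at cell 1 + 2 m,
    below [base]. Each round takes nine instructions and the exit jump one. *)
Lemma reach_pairs i x4 x6 mm : i <= n ->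
  exists x4' x6' mm',
    reach w P (9 * i + 1)
      (Config 17 (nth 0 [:: 0; n; m; 1; x4; i; x6; 3 * n; base]) mm)
      (Config 26 (nth 0 [:: 0; n; m; 1; x4'; 0; x6'; 3 * n; base]) mm')
    /\ forall j, mm' j = if base <= j < base + 2 * i
                         then nth 0 input_pairs (j - base) else mm j.
Proof.
elim: i x4 x6 mm => [|i IH] x4 x6 mm lei.
  exists x4, x6, mm; split => [|j]; last by case: ifP => //; lia.
  by exec_side reach_jump; [reflexivity|apply: reach_refl].
have [x4' [x6' [mm' [H Hmm]]]] :=
  IH (2 * i + base).+1 (3 * n + i)
     (writes mm (2 * i + base) [:: i; 3 * n + i]) (ltnW lei).
exists x4', x6', mm'; split.
  rewrite (_ : 9 * i.+1 + 1 = 9 + (9 * i + 1)); last by lia.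
  apply: reach_trans H.
  exec_side reach_nojump; first by lia.
  exec_side reach_sub; first by lia.
  rewrite subn1 /=.
  exec_side reach_add; first by rewrite /base; lia.
  exec_side reach_add; first by rewrite /base; lia.
  exec reach_write.
  exec_side reach_add; first by rewrite /base; lia.
  exec_side reach_add; first by lia.
  exec reach_write.
  exec_side reach_jump; first by reflexivity.
  by rewrite !addn1 mul2n -addnn; apply: reach_refl.
move=> j; rewrite Hmm writesE /=.
have [P0 P1] := nth_input_pairs lei.
have [lt1|ge1] := ltnP j (base + 2 * i).
  have [leb|ltb] := leqP base j; rewrite /=; first by rewrite ifT //; lia.
  by rewrite ifF //; lia.
have [lt2|ge2] := ltnP j (base + 2 * i.+1); last by rewrite !ifF //; lia.
rewrite ifF; last by lia.
rewrite ifT; last by lia.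
rewrite ifT; last by lia.
have [->|->] : j = base + 2 * i \/ j = base + (2 * i).+1 by lia.
  by rewrite addKn P0 (_ : _ - _ = 0) //; lia.
by rewrite addKn P1 (_ : _ - _ = 1) //; lia.
Qed.

(** Loop invariant with [i] edges still to process; cells between the two ranges are unconstrained.
    Cell 2 holds an endpoint of edge 0 until the end, so the number of pairs is stored there
    last. *)
Definition edges_left i (mm : nat -> nat) :=
  [/\ mm 0 = 4 * n, mm 1 = 6 * m,
      forall j, 1 < j < 2 + 2 * i -> mm j = nth 0 (triangle_input n E) j
    & forall j, 3 + 12 * i <= j -> mm j = nth 0 (layered_input n E) j].

Lemma reach_edges i x4 x5 x6 x7 x8 mm : i <= m -> edges_left i mm ->
  exists x4' x5' x6' x7' x8' mm',
    reach w P (50 * i + 1)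
      (Config 26 (nth 0 [:: 0; n; i; 1; x4; x5; x6; x7; x8]) mm)
      (Config 75 (nth 0 [:: 0; n; 0; 1; x4'; x5'; x6'; x7'; x8']) mm')
    /\ edges_left 0 mm'.
Proof.
elim: i x4 x5 x6 x7 x8 mm => [|i IH] x4 x5 x6 x7 x8 mm lei Hmm.
  exists x4, x5, x6, x7, x8, mm; split => //.
  by exec_side reach_jump; [reflexivity|apply: reach_refl].
pose e := nth (0, 0) E i.
have /E_lt/andP[lt1 lt2] : e \in E by apply: mem_nth.
have [mm0 mm1 old new] := Hmm.
have Hu : mm (2 * i + 2) = e.1.
  rewrite old; last by lia.
  by rewrite addn2 /= mulnC -[i * 2]addn0 (nth_flatten_map (0, 0) (k := 2)).
have Hv : mm (2 * i + 2).+1 = e.2.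
  rewrite old; last by lia.
  by rewrite addn2 /= mulnC -addn1 (nth_flatten_map (0, 0) (k := 2)).
have Hmm' : edges_left i (writes mm (12 * i + 3) (edge_cells n e)).
  split=> [| |j jlt|j jge]; rewrite writesE /=.
  - by rewrite ifF //; lia.
  - by rewrite ifF //; lia.
  - by rewrite ifF ?old //; lia.
  case: ifP => [jlt|jlt]; last by apply: new; lia.
  have -> : j = (i * 12 + (j - (12 * i + 3))).+3 by lia.
  rewrite [RHS]/= nth_cat (@size_flatten_map _ _ 12) // -/m ifT; last by lia.
  rewrite (nth_flatten_map (0, 0) (k := 12)) //; last by lia.
  by congr nth; lia.
have [y4 [y5 [y6 [y7 [y8 [mm' [H Hend]]]]]]] :=
  IH (12 * i + 3).+4.+4.+4 (e.1 + n + n + n) (e.2 + n + n + n)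
     (e.1 + n + n + n) (e.2 + n + n + n) _ (ltnW lei) Hmm'.
exists y4, y5, y6, y7, y8, mm'; split => //.
(* Twelve steps fetch the edge and compute its target address, three times twelve write the layers,
   and the jump back is rounded up to 2. *)
rewrite (_ : 50 * i.+1 + 1 = 12 + (12 + (12 + (12 + (2 + (50 * i + 1))))));
  last by lia.
apply: (@reach_trans _ _ 12 _ _
  (Config 38 (nth 0 [:: 0; n; i; 1; 12 * i + 3; e.1; e.2; 3; x8]) mm)).
  exec_side reach_nojump; first by lia.
  exec_side reach_sub; first by lia.
  rewrite subn1 /=.
  exec_side reach_add; first by lia.
  exec_side reach_const; first by lia.
  exec_side reach_add; first by lia.
  exec reach_read.
  exec_side reach_add; first by lia.
  exec reach_read.
  exec_side reach_const; first by lia.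
  exec_side reach_mul; first by lia.
  exec_side reach_const; first by lia.
  exec_side reach_add; first by lia.
  by rewrite addnn -mul2n addn1 Hu Hv; apply: reach_refl.
apply: reach_trans; first by apply: (@reach_layer 38); rewrite // ?inE //; lia.
apply: reach_trans; first by apply: (@reach_layer 50); rewrite // ?inE //; lia.
apply: reach_trans; first by apply: (@reach_layer 62); rewrite // ?inE //; lia.
apply: reach_trans H.
exec_side reach_jump; first by reflexivity.
rewrite /edge_cells !writes_cat [size _]/= !addn4.
exact: reach_refl.
Qed.

(** Registers end up zero and memory holds exactly the new input, as in an initial configuration;
    only the program counter differs. *)
Lemma reach_prologue :
  reach w P (30 + 9 * n + 50 * m) (initial (triangle_input n E))
    (Config (size prologue) (fun=> 0) (nth 0 (layered_input n E))).
Proof.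
have -> : initial (triangle_input n E) =
    Config 0 (nth 0 (nseq 9 0)) (nth 0 (triangle_input n E)).
  by congr Config; apply/funext => j; rewrite nth_nseq if_same.
rewrite (_ : 30 + 9 * n + 50 * m = 16 + ((9 * n + 1) + ((50 * m + 1) + 12)));
  last by lia.
pose mm0 := update (update (nth 0 (triangle_input n E)) 0 (4 * n)) 1 (6 * m).
apply: (@reach_trans _ _ 16 _ _
  (Config 17 (nth 0 [:: 0; n; m; 1; 3; n; 0; 3 * n; base]) mm0)).
  exec reach_read.
  exec_side reach_nojump; first by [].
  exec_side reach_jump; first by [].
  exec_side reach_const; first by lia.
  exec reach_read.
  exec_side reach_const; first by lia.
  exec_side reach_mul; first by [].
  exec reach_write.
  exec_side reach_const; first by lia.
  exec_side reach_mul; first by rewrite /= -/m; lia.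
  exec reach_write.
  exec_side reach_add; first by rewrite /= -/m; lia.
  exec_side reach_const; first by lia.
  exec_side reach_add; first by rewrite /= -/m; lia.
  exec_side reach_mul; first by rewrite /=; lia.
  exec_side reach_add; first by rewrite /=; lia.
  rewrite addn0.
  exact: reach_refl.
have [x4 [x6 [mm1 [H1 E1]]]] := @reach_pairs n 3 0 mm0 (leqnn n).
apply: reach_trans H1 _.
have left1 : edges_left m mm1.
  split=> [| |j jlt|j jge]; rewrite E1 /base.
  - by rewrite ifF //; lia.
  - by rewrite ifF //; lia.
  - rewrite ifF; last by lia.
    by case: j jlt => [|[|j]].
  have -> : j = (j - 3).+3 by lia.
  rewrite [RHS]/= nth_cat (@size_flatten_map _ _ 12) // -/m.
  rewrite [X in _ = X]ifF; last by lia.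
  have -> : (j - 3).+3 - (6 * m + 6 * m + 3) = j - 3 - m * 12 by lia.
  (* Past the last pair both sides are 0 by default, since the triangle input ended earlier. *)
  case: ifP => // out; rewrite [RHS]nth_default.
    rewrite /mm0 /update /= nth_default //.
    by rewrite (@size_flatten_map _ _ 2) // -/m; lia.
  by rewrite (@size_flatten_map _ _ 2) // size_iota; lia.
have [y4 [y5 [y6 [y7 [y8 [mm2 [H2 [a0 a1 _ new]]]]]]]] :=
  @reach_edges m x4 0 x6 (3 * n) base mm1 (leqnn m) left1.
apply: reach_trans H2 _.
exec_side reach_const; first by lia.
exec reach_write.
do 8![exec_side reach_const; first by lia].
rewrite (_ : nth 0 _ = fun=> 0); last first.
  by apply/funext; do 9?[case=> //]; move=> ?; rewrite /= nth_nil.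
rewrite (_ : update _ _ _ = nth 0 (layered_input n E)); first exact: reach_refl.
apply/funext => j; rewrite /update.
by case: eqP => [-> //|ne]; case: j ne => [|[|[|j]]] // _; apply: new; lia.
Qed.

End Prologue.

(** * The compiled program *)

Lemma step_halted w P c : halted P c -> step w P c = c.
Proof. by rewrite /halted /step; case: (current P c). Qed.

Lemma iter_halted w P c t : halted P c -> iter t (step w P) c = c.
Proof. by move=> h; elim: t => //= t ->; apply: step_halted. Qed.

(* Register 0 stays zero, which makes [Jz 0] an unconditional jump. *)
Definition translate (L len : nat) (i : instr) : instr :=
  match i with
  | Const r x => Const r.+1 x
  | Bin o r s t => Bin o r.+1 s.+1 t.+1
  | Read r s => Read r.+1 s.+1
  | Write r s => Write r.+1 s.+1
  | Jz r l => Jz r.+1 (L + minn l len)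
  | Halt => Jz 0 (L + len)
  end.

(* Dividing rather than comparing y with 5 z avoids an overflow. *)
Definition epilogue (pos : nat) : program :=
  [:: Jz 2 (pos + 4); Bin Div 3 1 2; Const 4 5; Bin Less 0 3 4].

Definition reduction (P : program) : program :=
  let L := size prologue in
  prologue ++ [seq translate L (size P) i | i <- P] ++ epilogue (L + size P).

(** As 5 is an integer, y / z < 5 can be tested on the integer quotient; z = 0 encodes an infinite
    output. *)
Definition below_five (y z : nat) : bool := (z != 0) && (y %/ z < 5).

(** The form [iter k succn pos] lets program counters match by computation for an abstract [pos]. At
    k = 4 the default [Halt] stops the machine. *)
Lemma run_epilogue w Q pos r m : 5 < 2 ^ w ->
  (forall k, nth Halt Q (iter k succn pos) = nth Halt (epilogue pos) k) ->
  r 0 = 0 ->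
  exists2 c, reach w Q 4 (Config pos r m) c &
    halted Q c /\ reg c 0 = below_five (r 1) (r 2).
Proof.
move=> w5 code r0; rewrite /below_five.
have [z0|z0] := eqVneq (r 2) 0.
  exists (Config (pos + 4) r m).
    apply: reach_step; rewrite /step /current /= (code 0) /= z0 /=.
    exact: reach_refl.
  by rewrite /halted /current /= addn4 (code 4) /= r0.
pose r3 := update (update r 3 (r 1 %/ r 2)) 4 5.
exists (Config (iter 4 succn pos) (update r3 0 (r 1 %/ r 2 < 5)) m).
  apply: reach_step; rewrite /step /current /= (code 0) /= (negPf z0).
  apply: reach_step; rewrite /step /current /= (code 1) /=.
  apply: reach_step; rewrite /step /current /= (code 2) /= modn_small //.
  apply: reach_step; rewrite /step /current /= (code 3) /=.
  exact: reach_refl.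
by rewrite /halted /current /= (code 4).
Qed.

(** * Simulation of the given program, one instruction at a time *)

Section Simulation.
Variables (w : nat) (P : program).
Let L := size prologue.
Let P' := reduction P.

(** The [minn] identifies all program counters beyond the code of [P], where [P] halts, with the
    start of the epilogue. *)
Definition simulates (c c' : config) : Prop :=
  [/\ pc c' = L + minn (pc c) (size P), reg c' 0 = 0,
      forall r, reg c' r.+1 = reg c r & Defs.mem c' = Defs.mem c].

Lemma nth_reduction k :
  k < size P -> nth Halt P' (L + k) = translate L (size P) (nth Halt P k).
Proof.
move=> lt; rewrite nth_cat ltnNge leq_addr /= addKn nth_cat size_map lt.
by rewrite (nth_map Halt).
Qed.

Lemma nth_reduction_epilogue k :
  nth Halt P' (L + size P + k) = nth Halt (epilogue (L + size P)) k.
Proof.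
rewrite nth_cat -addnA ltnNge leq_addr /= addKn nth_cat size_map.
by rewrite ltnNge leq_addr /= addKn.
Qed.

Lemma simulates_update c c' p p' r v : simulates c c' ->
  p' = L + minn p (size P) ->
  simulates (Config p (update (reg c) r v) (Defs.mem c))
            (Config p' (update (reg c') r.+1 v) (Defs.mem c')).
Proof.
by move=> [_ r0 rS mE] ->; split=> //= s; rewrite /update eqSS rS.
Qed.

Lemma simulates_step c c' : ~~ halted P c -> simulates c c' ->
  simulates (step w P c) (step w P' c').
Proof.
move=> nh sim; have [pcE r0 rS mE] := sim.
have lt : pc c < size P.
  rewrite ltnNge; apply: contra nh => ge.
  by rewrite /halted /current nth_default.
have pcS : (pc c').+1 = L + minn (pc c).+1 (size P).
  by rewrite pcE (minn_idPl (ltnW lt)) (minn_idPl lt) addnS.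
move: nh; rewrite /halted /step /current.
rewrite pcE (minn_idPl (ltnW lt)) nth_reduction //.
case: (nth Halt P (pc c)) => [r x|o r s t|r s|r s|r l|] //= _.
- by apply: simulates_update => //; rewrite -pcS pcE (minn_idPl (ltnW lt)).
- rewrite !rS; apply: simulates_update => //.
  by rewrite -pcS pcE (minn_idPl (ltnW lt)).
- rewrite rS (congr1 (fun f => f _) mE); apply: simulates_update => //.
  by rewrite -pcS pcE (minn_idPl (ltnW lt)).
- by split; rewrite //= -?pcS ?pcE ?(minn_idPl (ltnW lt)) // mE !rS.
- split=> //=; rewrite rS; case: eqP => // _.
  by rewrite -pcS pcE (minn_idPl (ltnW lt)).
Qed.

(** Once [P] has halted the simulating machine must be held back, as it would run on into the
    epilogue; hence only [t' <= t]. *)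
Lemma simulates_iter c c' t : simulates c c' -> exists2 t', t' <= t &
  simulates (iter t (step w P) c) (iter t' (step w P') c').
Proof.
move=> sim; elim: t => [|t [t' let' IH]]; first by exists 0.
have [h|nh] := boolP (halted P (iter t (step w P) c)).
  by exists t'; [apply: leq_trans let' _|rewrite /= step_halted].
by exists t'.+1; last exact: simulates_step.
Qed.

(** [P] stops either at an explicit [Halt], translated into one jump, or by leaving its code, which
    is already the epilogue: at most one step besides the four of the epilogue. *)
Lemma reach_epilogue c c' : 5 < 2 ^ w -> halted P c -> simulates c c' ->
  exists2 c'', reach w P' 5 c' c'' &
    halted P' c'' /\ reg c'' 0 = below_five (reg c 0) (reg c 1).
Proof.
move=> w5 h sim.
have [c1 H1 [pc1 r0 rS mE]] : exists2 c1, reach w P' 1 c' c1 &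
    [/\ pc c1 = L + size P, reg c1 0 = 0,
        forall r, reg c1 r.+1 = reg c r & Defs.mem c1 = Defs.mem c].
  have [pcE r0 rS mE] := sim.
  have [lt|ge] := ltnP (pc c) (size P); last first.
    exists c'; first exact: reach_le (reach_refl _ _ 0 _).
    by split; rewrite // pcE (minn_idPr ge).
  exists (step w P' c'); first exact/reach_step/reach_refl.
  rewrite /step /current pcE (minn_idPl (ltnW lt)) nth_reduction //.
  move: h; rewrite /halted /current.
  by case: (nth Halt P (pc c)) => //= _; rewrite r0.
have code k : nth Halt P' (iter k succn (L + size P)) =
    nth Halt (epilogue (L + size P)) k.
  by rewrite iter_succn nth_reduction_epilogue.
case: c1 H1 pc1 r0 rS mE => p r1 m1 H1 /= pE r0 rS _.
rewrite {}pE in H1; rewrite -!rS.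
have [c'' H2 res] := run_epilogue m1 w5 code r0.
by exists c''; first exact: (@reach_trans _ _ 1 4 _ _ _ H1 H2).
Qed.

End Simulation.

Section Reduction.
Variables (w n : nat) (E : seq (nat * nat)) (P : program).
Hypothesis fit : fits w (layered_input n E).
Hypothesis E_lt : forall e : nat * nat, e \in E -> (e.1 < n) && (e.2 < n).

(** The constant 35 is 30 for the prologue plus 5 for the epilogue. If n = 0 the prologue itself
    halts, so that case is left aside. *)
Lemma reduction_correct t : 0 < n ->
  let c := run w P (layered_input n E) t in halted P c ->
  exists2 t', t' <= t + (35 + 9 * n + 50 * size E) &
    let c' := run w (reduction P) (triangle_input n E) t' in
    halted (reduction P) c' /\ reg c' 0 = below_five (reg c 0) (reg c 1).
Proof.
move=> n_gt0 c h; have /andP[fit_size /= /andP[fit_n _]] := fit.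
have w5 : 5 < 2 ^ w.
  move: fit_size; rewrite size_layered_input => fit_size.
  have : 5 <= 2 ^ w by lia.
  by case: w => [|[|[|k]]] // _; rewrite !expnS; have := expn_gt0 2 k; lia.
have [t1 le1 E1] := reach_prologue
  ([seq translate (size prologue) (size P) i | i <- P]
     ++ epilogue (size prologue + size P)) n_gt0 fit_size fit_n E_lt.
have sim0 : simulates P (initial (layered_input n E))
    (Config (size prologue) (fun=> 0) (nth 0 (layered_input n E))).
  by split=> //=; rewrite min0n.
have [t2 le2 sim] := simulates_iter w t sim0.
have [c'' [t3 le3 E3] res] := reach_epilogue w5 h sim.
exists (t3 + (t2 + t1)); first by lia.
by rewrite /run !iterD E1 -/(reduction P) E3.
Qed.

End Reduction.

(** * The layered graph *)

Lemma map_uniq_inj (T1 T2 : eqType) (f : T1 -> T2) (s : seq T1) :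
  uniq (map f s) -> {in s &, injective f}.
Proof.
elim: s => //= x s IH /andP[xs us] y z.
rewrite !inE => /predU1P[->|ys] /predU1P[->|zs] // E; last exact: IH.
  by case/negP: xs; rewrite E map_f.
by case/negP: xs; rewrite -E map_f.
Qed.

Lemma adj_sym (G : graph) : symmetric (@adj G).
Proof. by move=> u v; rewrite /adj orbC. Qed.

(* The reduction modulo 4 only serves to make [vtx] total: k < 4 in all uses. *)
Lemma vtx_subproof n k (u : 'I_n) : k %% 4 * n + u < 4 * n.
Proof.
have : k %% 4 < 4 by rewrite ltn_pmod.
by have := ltn_ord u; nia.
Qed.

Definition vtx n k (u : 'I_n) : 'I_(4 * n) := Ordinal (vtx_subproof k u).

Lemma vtx_inj n k l (u v : 'I_n) :
  k < 4 -> l < 4 -> vtx k u = vtx l v -> k = l /\ u = v.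
Proof.
move=> lt4k lt4l /(congr1 val) /=; rewrite !modn_small // => E.
have n0 : 0 < n by apply: leq_ltn_trans (ltn_ord u).
split; last apply: val_inj.
  by have := congr1 (divn^~ n) E; rewrite !divnMDl // !divn_small // !addn0.
by have := congr1 (modn^~ n) E; rewrite !modnMDl !modn_small.
Qed.

Lemma vtx_surj n (x : 'I_(4 * n)) : exists k u, k < 4 /\ x = @vtx n k u.
Proof.
have n0 : 0 < n.
  by have := leq_ltn_trans (leq0n _) (ltn_ord x); rewrite muln_gt0.
have lt4 : x %/ n < 4 by rewrite ltn_divLR.
exists (x %/ n), (Ordinal (ltn_pmod x n0)); split=> //.
by apply: val_inj; rewrite /= modn_small // -divn_eq.
Qed.

Lemma vtx_layer_neq n k (u v : 'I_n) : k < 3 -> vtx k u != vtx k.+1 v.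
Proof. by move=> lt; apply/eqP => /vtx_inj[] //; lia. Qed.

(** Matching the endpoints crosswise would force both k = l + 1 and l = k + 1. *)
Lemma layered_set_inj n k l (a b c d : 'I_n) : k < 3 -> l < 3 ->
  [set vtx k a; vtx k.+1 b]%SET = [set vtx l c; vtx l.+1 d]%SET ->
  [/\ k = l, a = c & b = d].
Proof.
move=> ltk ltl /setP E.
have := E (vtx k a); rewrite !inE eqxx /= => /esym/orP[]/eqP/vtx_inj[];
  try lia; last first.
  move=> kE _; have := E (vtx l c).
  rewrite !inE eqxx /= => /orP[]/eqP/vtx_inj[]; lia.
move=> kE ac; subst l c; have := E (vtx k.+1 b).
rewrite !inE eqxx orbT => /esym/orP[]/eqP/vtx_inj[]; try lia.
by move=> _ ->.
Qed.

(** The order is the one in which the prologue emits the edges; the boolean asks for the reversed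
    orientation. *)
Definition layer_slots : seq (nat * bool) :=
  [:: (0, false); (0, true); (1, false); (1, true); (2, false); (2, true)].

Definition layered_edge n (e : 'I_n * 'I_n) (s : nat * bool) :=
  let (u, v) := if s.2 then (e.2, e.1) else e in (vtx s.1 u, vtx s.1.+1 v).

Section Layered.
Variable G : graph.
Let n := num_vertices G.

Definition layered_edges :=
  [seq layered_edge e s | e <- edges G, s <- layer_slots].

Lemma layer_slots_lt s : s \in layer_slots -> s.1 < 3.
Proof. by rewrite !inE; do 5!case/orP => [/eqP->//|]; move/eqP->. Qed.

Lemma layered_edges_loopless : all (fun e => e.1 != e.2) layered_edges.
Proof.
apply/all_allpairsP => e s _ /layer_slots_lt lt.
by rewrite /layered_edge; case: ifP => _; [|case: e => u v];
  apply: vtx_layer_neq.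
Qed.

Lemma layered_edges_uniq :
  uniq [seq [set e.1; e.2]%SET | e <- layered_edges].
Proof.
rewrite map_allpairs; apply: allpairs_uniq => //.
  by have := edges_uniq G; apply: map_uniq.
have slot x : x \in [seq (e, s) | e <- edges G, s <- layer_slots] ->
    x.1 \in edges G /\ x.2.1 < 3.
  by case/allpairsP => -[e s] /= [eG /layer_slots_lt lt ->].
move=> [[u v] [k o]] [[u' v'] [k' o']] /slot[/= eG ltk] /slot[/= e'G ltk'].
(* Only one orientation of an edge is listed, so slot [false] of (u, v) never meets slot [true] of
   (v, u). *)
have flip x y : (x, y) \in edges G -> (y, x) \notin edges G.
  move=> xy; apply/negP => yx.
  have xy_neq := allP (edges_loopless G) _ xy.
  have /eqP := map_uniq_inj (edges_uniq G) xy yx (setUC _ _).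
  by rewrite xpair_eqE (negPf (xy_neq : x != y)).
rewrite /layered_edge /=.
case: o o' => [] [] /= /layered_set_inj[] // -> ? ?; subst=> //.
  by have := flip _ _ eG; rewrite e'G.
by have := flip _ _ eG; rewrite e'G.
Qed.

Definition layered_graph : graph :=
  Graph layered_edges_loopless layered_edges_uniq.

Lemma num_edges_layered : num_edges layered_graph = 6 * num_edges G.
Proof. by rewrite /num_edges size_allpairs mulnC. Qed.

Lemma adj_layered k (u v : 'I_n) :
  k < 3 -> adj u v -> @adj layered_graph (vtx k u) (vtx k.+1 v).
Proof.
move=> lt3 auv.
have slot o : (k, o) \in layer_slots by case: k o lt3 => [|[|[|]]] [].
apply/orP; left; apply/allpairsP; case/orP: auv => uv.
  by exists ((u, v), (k, false)); split=> //=; apply: slot.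
by exists ((v, u), (k, true)); split=> //=; apply: slot.
Qed.

Lemma layered_adj (x y : 'I_(4 * n)) : @adj layered_graph x y ->
  exists k l a b, [/\ x = vtx k a, y = vtx l b, adj a b, k < 4 /\ l < 4
                    & k = l.+1 \/ l = k.+1].
Proof.
have edge p : p \in layered_edges -> exists k a b,
    [/\ p = (vtx k a, vtx k.+1 b), adj a b & k < 3].
  move=> /allpairsP[[[u v] [k o]] /= [eG /layer_slots_lt /= lt ->]].
  by case: o; [exists k, v, u|exists k, u, v]; split=> //; rewrite /adj eG ?orbT.
case/orP => /edge[k [a [b [[-> ->] ab lt]]]].
  by exists k, k.+1, a, b; split=> //; [lia|right].
exists k.+1, k, b, a; split=> //; [by rewrite adj_sym|lia|by left].
Qed.

Lemma no_isolated_layered : no_isolated G -> no_isolated layered_graph.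
Proof.
move=> iso x; have [k [u [lt4 ->]]] := vtx_surj x; have [v uv] := iso u.
have [lt3|ge3] := ltnP k 3; first by exists (vtx k.+1 v); apply: adj_layered.
exists (vtx 2 v); rewrite adj_sym (_ : k = 3); last by lia.
by apply: adj_layered => //; rewrite adj_sym.
Qed.

Definition layered_pairs := [seq (vtx 0 u, vtx 3 u) | u <- enum 'I_n].

Lemma triangle_path : has_triangle G -> exists u p,
  [/\ path (@adj layered_graph) (vtx 0 u) p, last (vtx 0 u) p = vtx 3 u
    & size p = 3].
Proof.
move=> [u [v [w [uv vw wu]]]]; exists u, [:: vtx 1 v; vtx 2 w; vtx 3 u].
by split; rewrite //= !adj_layered.
Qed.

(** Each step changes the layer by one, so a path from layer 0 to layer 3 has odd length at least 3.
    Length 3 visits the layers in order and projects to a closed walk of length 3 in [G]. *)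
Lemma path_triangle u p :
  path (@adj layered_graph) (vtx 0 u) p -> last (vtx 0 u) p = vtx 3 u ->
  size p < 5 -> has_triangle G.
Proof.
have vtxE k l (a b : 'I_n) :
    vtx k a = vtx l b -> k < 4 -> l < 4 -> k = l /\ a = b.
  by move=> /[swap] + /[swap] => *; apply: vtx_inj.
case: p => [|x1 p] /=; first by move=> _ /vtxE[].
case/andP => /layered_adj[k0 [k1 [a0 [a1 [E0 -> A01 [lt0 lt1] s01]]]]].
have [//|//|k0E a0E] := vtxE _ _ _ _ E0; subst k0 a0.
have {s01} k1E : k1 = 1 by lia.
case: p => [|x2 p] /=; first by move=> _ /vtxE[]; lia.
case/andP => /layered_adj[l1 [k2 [b1 [a2 [E1 -> A12 [lt1' lt2] s12]]]]].
have [//|//|l1E b1E] := vtxE _ _ _ _ E1; subst l1 b1.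
case: p => [|x3 p] /=; first by move=> _ /vtxE[]; lia.
case/andP => /layered_adj[l2 [k3 [b2 [a3 [E2 -> A23 [lt2' lt3] s23]]]]].
have [//|//|l2E b2E] := vtxE _ _ _ _ E2; subst l2 b2.
case: p => [|x4 p] /=.
  by move=> _ /vtxE[]// _ ? _; subst a3; exists u, a1, a2.
case/andP => /layered_adj[l3 [k4 [b3 [a4 [E3 -> A34 [lt3' lt4] s34]]]]].
have [//|//|l3E b3E] := vtxE _ _ _ _ E3; subst l3 b3.
by case: p => //= _ /vtxE[]; lia.
Qed.

Lemma encode_layered_edges :
  flat_pairs layered_edges =
  flatten [seq edge_cells n e
          | e <- [seq (val e.1, val e.2) | e <- edges G]].
Proof.
rewrite /layered_edges; elim: (edges G) => //= e s <-.
case: e => u v; rewrite /flat_pairs /edge_cells /= /n.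
by do 12![congr cons; try by rewrite ?mulSn ?mul0n; lia].
Qed.

Lemma encode_layered_pairs :
  flat_pairs layered_pairs = flatten [seq [:: i; 3 * n + i] | i <- iota 0 n].
Proof. by rewrite /flat_pairs -val_enum_ord -!map_comp. Qed.

End Layered.

(** * Distances and their minimum over the query pairs *)

Section MinDist.
Variables (R : realType) (G : graph).
Implicit Types (s t : 'I_(num_vertices G))
  (ps : seq ('I_(num_vertices G) * 'I_(num_vertices G))).

Lemma dist_le s p :
  path (@adj G) s p -> (dist R s (last s p) <= (size p)%:R%:E)%E.
Proof.
by move=> sp; apply: ge_ereal_inf; exists (size p)%:R%:E => //; exists p.
Qed.

Lemma dist_ge s t k :
  (forall p, path (@adj G) s p -> last s p = t -> k <= size p) ->
  (k%:R%:E <= dist R s t)%E.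
Proof.
move=> H; apply: le_ereal_inf_tmp => _ [p [sp pt] <-] /=.
by rewrite lee_fin ler_nat H.
Qed.

Lemma dist_disconnected s t :
  (forall p, path (@adj G) s p -> last s p <> t) -> dist R s t = +oo%E.
Proof.
move=> H; apply/eqP; rewrite -leye_eq.
apply: le_ereal_inf_tmp => d [p [sp pt] _].
by have := H p sp.
Qed.

Lemma min_dist_le ps st : st \in ps -> (min_dist R ps <= dist R st.1 st.2)%E.
Proof. by move=> st_ps; apply: ge_bigmin_seq. Qed.

Lemma min_dist_ge ps k :
  (forall st p, st \in ps -> path (@adj G) st.1 p -> last st.1 p = st.2 ->
     k <= size p) ->
  (k%:R%:E <= min_dist R ps)%E.
Proof.
move=> H; rewrite /min_dist big_seq; apply: le_bigmin; first exact: leey.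
by move=> st st_ps; apply: dist_ge => p; apply: H.
Qed.

Lemma min_dist_ge0 ps : (0 <= min_dist R ps)%E.
Proof. exact: (@min_dist_ge _ 0). Qed.

End MinDist.

(** * The adversary *)

Definition address_read (P : program) (c : config) : option nat :=
  if current P c is Read _ s then Some (reg c s) else None.

Definition addresses_read w P input t : seq nat :=
  pmap (fun i => address_read P (run w P input i)) (iota 0 t).

Definition agree_off (S : pred nat) (c c' : config) : Prop :=
  [/\ pc c = pc c', reg c = reg c'
    & forall j, ~~ S j -> Defs.mem c j = Defs.mem c' j].

(** Writes put equal values at equal addresses, so only a read inside [S] can separate the two
    runs. *)
Lemma agree_off_step w P S c c' :
  (forall a, address_read P c = Some a -> ~~ S a) ->
  agree_off S c c' -> agree_off S (step w P c) (step w P c').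
Proof.
case: c c' => [p r m] [_ _ m'] /= H [/= <- <- mE]; move: H.
rewrite /address_read /step /current /=.
case: (nth Halt P p) => [x y|o x y z|x y|x y|x l|] //= H.
  by split=> //=; rewrite mE // H.
by split=> //= j Sj; rewrite /update; case: eqP => // _; apply: mE.
Qed.

Lemma agree_off_run w P S input input' t :
  (forall j, ~~ S j -> nth 0 input j = nth 0 input' j) ->
  (forall a, a \in addresses_read w P input t -> ~~ S a) ->
  agree_off S (run w P input t) (run w P input' t).
Proof.
move=> eq_in; elim: t => [|t IH] H; first by split.
apply: agree_off_step => [a Ha|]; last first.
  apply: IH => a; rewrite mem_pmap => /mapP[i].
  rewrite mem_iota => /andP[_ lt] E.
  by apply: H; rewrite mem_pmap E map_f // mem_iota; lia.
by apply: H; rewrite mem_pmap -Ha map_f // mem_iota; lia.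
Qed.

Lemma halted_run_eq w P input t t' :
  halted P (run w P input t) -> halted P (run w P input t') ->
  run w P input t = run w P input t'.
Proof.
wlog le : t t' / t <= t' => [W|h _].
  by case: (leqP t t') => [/W//|/ltnW/W W' h h']; rewrite W'.
by rewrite -(subnK le) /run iterD -/(run w P input t) iter_halted.
Qed.

(** Pigeonhole: a step reads at most one cell, so fewer than m blocks are touched. Block i is the
    pair of cells of edge i, after a header of three cells. *)
Lemma unread_block w P input t m : t < m ->
  exists2 i, i < m & forall a, a \in addresses_read w P input t ->
    (a != 3 + 2 * i) && (a != 4 + 2 * i).
Proof.
(* Truncated subtraction charges header cells to block 0, which can only mark more blocks as
   read. *)
move=> lt; pose blocks := [seq (a - 3) %/ 2 | a <- addresses_read w P input t].
have /allPn[i] : ~~ all (mem blocks) (iota 0 m).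
  apply: contraL lt => /allP sub; rewrite -leqNgt.
  have := uniq_leq_size (iota_uniq 0 m) sub; rewrite size_iota => le.
  apply: leq_trans le _.
  by rewrite size_map size_pmap -[leqRHS](size_iota 0) count_size.
rewrite mem_iota /= => ltm nblock; exists i => // a Ha.
apply/andP; split; apply: contra nblock => /eqP aE; apply/mapP; exists a => //;
  rewrite aE; lia.
Qed.

Lemma nth_cat2 (s1 s2 : seq nat) a b a' b' j :
  j != size s1 -> j != (size s1).+1 ->
  nth 0 (s1 ++ a :: b :: s2) j = nth 0 (s1 ++ a' :: b' :: s2) j.
Proof.
move=> j1 j2; rewrite !nth_cat; case: ltnP => // le.
by have -> : j - size s1 = (j - size s1 - 2).+2 by lia.
Qed.

Lemma flat_pairs_cat n (s1 s2 : seq ('I_n * 'I_n)) :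
  flat_pairs (s1 ++ s2) = flat_pairs s1 ++ flat_pairs s2.
Proof. by rewrite /flat_pairs map_cat flatten_cat. Qed.

Lemma size_flat_pairs n (s : seq ('I_n * 'I_n)) :
  size (flat_pairs s) = 2 * size s.
Proof. by rewrite (@size_flatten_map _ _ 2) // mulnC. Qed.

(* The bipartite graph between layers 0 and 1 never joins the query pair, which
   is the extra edge between layers 2 and 3. *)
Section Adversary.
Variable q : nat.
Let n := q.+1.

Definition bipartite_edges : seq ('I_(4 * n) * 'I_(4 * n)) :=
  [seq (vtx 0 u, vtx 1 v) | u <- enum 'I_n, v <- enum 'I_n].

Definition query : 'I_(4 * n) * 'I_(4 * n) := (vtx 2 ord0, vtx 3 ord0).

Lemma size_bipartite_edges : size bipartite_edges = n ^ 2.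
Proof. by rewrite size_allpairs size_enum_ord mulnn. Qed.

Lemma query_edgeP e : e \in query :: bipartite_edges ->
  exists k u v, k < 3 /\ e = (vtx k u, vtx k.+1 v).
Proof.
rewrite inE => /predU1P[->|/allpairsP[[u v] [_ _ ->]]].
  by exists 2, ord0, ord0.
by exists 0, u, v.
Qed.

Lemma query_loopless : all (fun e => e.1 != e.2) (query :: bipartite_edges).
Proof.
apply/allP => e /query_edgeP[k [u [v [lt ->]]]] /=.
by apply/eqP => /vtx_inj[]; lia.
Qed.

Lemma query_uniq :
  uniq [seq [set e.1; e.2]%SET | e <- query :: bipartite_edges].
Proof.
rewrite map_inj_in_uniq.
  rewrite cons_uniq; apply/andP; split.
    by apply/allpairsP => -[[u v] [_ _ /(congr1 fst)/vtx_inj[]]].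
  apply: allpairs_uniq; rewrite ?enum_uniq // => -[u v] [u' v'] _ _ /= uvE.
  have [//|//|_ ->] := vtx_inj _ _ (congr1 fst uvE).
  by have [//|//|_ ->] := vtx_inj _ _ (congr1 snd uvE).
move=> e e' /query_edgeP[k [u [v [lt ->]]]] /query_edgeP[k' [u' [v' [lt' ->]]]].
by move=> /layered_set_inj[] // -> -> ->.
Qed.

Section Instances.
Variables (K : nat) (K_gt0 : 0 < K).

Lemma query_bound (G : graph) (st : 'I_(num_vertices G) * 'I_(num_vertices G)) :
  size [:: st] <= K * num_vertices G.
Proof.
by rewrite muln_gt0 K_gt0 (leq_ltn_trans (leq0n _) (ltn_ord st.1)).
Qed.

Definition query_instance es (l : all (fun e => e.1 != e.2) es)
    (u : uniq [seq [set e.1; e.2]%SET | e <- es]) : pairs_instance K :=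
  @PairsInstance K (Graph l u) [:: query] (@query_bound (Graph l u) query).

Lemma bipartite_loopless : all (fun e => e.1 != e.2) bipartite_edges.
Proof. by have /andP[] := query_loopless. Qed.

Lemma bipartite_uniq : uniq [seq [set e.1; e.2]%SET | e <- bipartite_edges].
Proof. by have /andP[] := query_uniq. Qed.

Definition bipartite_instance :=
  query_instance bipartite_loopless bipartite_uniq.

Variables (R : realType) (alpha : R).
Let Q := n_pairs_min_distance K alpha.

(** If t < n ^ 2, an unread edge can be replaced by the query pair without changing the word length,
    the other cells or the output. The distance drops from infinity to at most 1, which no ratio
    [alpha] tolerates. *)
Lemma bipartite_time P a b t :
  (forall x : instance Q, exists t', solves_in P a b x t') ->
  solves_in (Q := Q) P a b bipartite_instance t -> n ^ 2 <= t.
Proof.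
move=> tot [_ halt [out_ge _]]; rewrite leqNgt; apply/negP => lt.
set w := word_length _ _ _ in halt out_ge.
have [i lti unread] :=
  unread_block w P (encode (p := Q) bipartite_instance) lt.
have := size_bipartite_edges.
pose A := take i bipartite_edges; pose B := drop i.+1 bipartite_edges.
pose y := nth query bipartite_edges i => szE.
have defE : bipartite_edges = A ++ y :: B.
  by rewrite -drop_nth ?szE // cat_take_drop.
have l : all (fun e => e.1 != e.2) (A ++ query :: B).
  have := query_loopless.
  by rewrite defE /= !all_cat /= => /and4P[-> -> _ ->].
have u : uniq [seq [set e.1; e.2]%SET | e <- A ++ query :: B].
  have perm : perm_eq (A ++ query :: B) (query :: A ++ B).
    by rewrite -cat1s perm_catCA.
  have sub : subseq (query :: A ++ B) (query :: bipartite_edges).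
    by rewrite defE /= eqxx cat_subseq ?subseq_cons.
  rewrite (perm_uniq (perm_map _ perm)).
  exact: subseq_uniq (map_subseq _ sub) query_uniq.
pose x' : instance Q := query_instance l u.
pose S j := (j == 3 + 2 * i) || (j == 4 + 2 * i).
have szA : size A = i by rewrite size_take szE lti.
have eq_in j : ~~ S j ->
    nth 0 (encode (p := Q) bipartite_instance) j = nth 0 (encode x') j.
  rewrite /S negb_or => /andP[j1 j2].
  have szE' : size (A ++ query :: B) = size bipartite_edges.
    by rewrite defE !size_cat.
  rewrite /= /num_edges /= szE' [in flat_pairs bipartite_edges]defE.
  rewrite !flat_pairs_cat -!catA.
  by apply: (@nth_cat2 [:: 4 * n, size bipartite_edges, 1 & flat_pairs A]);
    rewrite /= size_flat_pairs szA; lia.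
have agree : agree_off S (run w P (encode (p := Q) bipartite_instance) t)
                         (run w P (encode x') t).
  by apply: agree_off_run => // j /unread; rewrite /S negb_or.
have [pcE regE _] := agree.
have [t' [_ halt' [_ out_le]]] := tot x'.
(* Equal program counters show that the run on [x'] has also halted at time [t], hence in the state
   known to be correct. *)
have runE : run w P (encode x') t' = run w P (encode x') t.
  by apply: halted_run_eq => //; move: halt; rewrite /halted /current pcE.
move: out_le; rewrite -/w runE -regE.
set c := run w P (encode (p := Q) bipartite_instance) t in out_ge *.
have -> : output_value R (reg c 0) (reg c 1) = +oo%E.
  apply/eqP; rewrite -leye_eq; apply: le_trans out_ge.
  rewrite /min_dist /= big_cons big_nil dist_disconnected //= => -[|v p] /=.
    by move=> _ /vtx_inj[].
  by case/andP => /orP[] /allpairsP[[u1 u2] [_ _]];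
    [move=> /(congr1 fst)|move=> /(congr1 snd)] => /vtx_inj[].
have d1 : (@min_dist R (Graph l u) [:: query] <= 1%:R%:E)%E.
  apply: (@le_trans _ _ (@dist R (Graph l u) query.1 query.2)).
    by apply: min_dist_le; rewrite mem_head.
  apply: (@dist_le R (Graph l u) query.1 [:: query.2]).
  by rewrite /= /adj mem_cat mem_head orbT.
have d0 := @min_dist_ge0 R (Graph l u) [:: query].
(* The minimum is finite, so its product with [alpha] is finite and cannot bound an infinite
   output. *)
have /fineK <- : (@min_dist R (Graph l u) [:: query]) \is a fin_num.
  by rewrite ge0_fin_numE // (le_lt_trans d1) ?ltry.
by rewrite -EFinM leye_eq.
Qed.

End Instances.
End Adversary.

(** * Time bounds *)

Local Open Scope ring_scope.

Lemma output_lt5 (R : realType) y z :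
  (output_value R y z < 5%:R%:E)%E = below_five y z.
Proof.
rewrite /output_value /below_five; case: eqP => [//|/eqP z0] /=.
rewrite lte_fin ltr_pdivrMr ?ltr0n ?lt0n // -natrM ltr_nat.
by rewrite ltn_divLR // lt0n.
Qed.

Section LayeredInstance.
Variables (K : nat) (K_gt0 : (0 < K)%N).

Lemma layered_pairs_bound G :
  (size (layered_pairs G) <= K * num_vertices (layered_graph G))%N.
Proof. by rewrite size_map size_enum_ord /=; nia. Qed.

Definition layered_instance G : pairs_instance K :=
  PairsInstance (pgraph := layered_graph G) (layered_pairs_bound G).

(** A triangle gives a minimum of at most 3 and an output below 3 (5/3) = 5; without one, every path
    joining a pair has length at least 5. *)
Lemma layered_instance_below_five (R : realType) (alpha : R) G y z :
  alpha < 5%:R / 3%:R ->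
  accepts (p := n_pairs_min_distance K alpha) (layered_instance G) y z ->
  below_five y z <-> has_triangle G.
Proof.
move=> lt_alpha /= [le_out out_le]; rewrite -(output_lt5 R); split; last first.
  move=> /triangle_path[u [p [sp pt sz]]].
  have d3 : (@min_dist R (layered_graph G) (layered_pairs G) <= 3%:R%:E)%E.
    apply: (@le_trans _ _ (@dist R (layered_graph G) (vtx 0 u) (vtx 3 u))).
      apply: (@min_dist_le R (layered_graph G) _ (vtx 0 u, vtx 3 u)).
      by apply/mapP; exists u; rewrite ?mem_enum.
    by have := dist_le R sp; rewrite pt sz.
  apply: le_lt_trans out_le _.
  have d0 := @min_dist_ge0 R (layered_graph G) (layered_pairs G).
  (* Multiplication by a negative [alpha] is not monotone; in that case the product is at most 0. *)
  have [a0|a0] := leP 0 alpha.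
    apply: le_lt_trans (lee_wpmul2l _ d3) _; rewrite ?lee_fin //.
    by rewrite -EFinM lte_fin; lra.
  apply: (@le_lt_trans _ _ 0%E); last by rewrite lte_fin.
  by apply: mule_le0_ge0 => //; rewrite lee_fin ltW.
move=> out5; apply: contrapT => noT.
have : (5%:R%:E <= output_value R y z)%E.
  apply: le_trans le_out; apply: min_dist_ge => st p /mapP[u _ ->] /= sp pt.
  by rewrite leqNgt; apply/negP => lt5; apply: noT (path_triangle sp pt lt5).
by rewrite leNgt out5.
Qed.

Lemma word_length4 a b n : (0 < n)%N ->
  word_length a (2 * a + b) n = word_length a b (4 * n).
Proof.
move=> n0; rewrite /word_length (_ : 4 * n = 2 * (2 * n))%N; last by lia.
by rewrite !trunc_logMp ?muln_gt0 //; lia.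
Qed.

(** The header of the layered input dominates all entries: 4 n bounds n and the endpoints, 6 m
    bounds m. *)
Lemma fits_triangle_input w n (E : seq (nat * nat)) :
  fits w (layered_input n E) ->
  (forall e : nat * nat, e \in E -> (e.1 < n) && (e.2 < n))%N ->
  fits w (triangle_input n E).
Proof.
case/andP; rewrite size_layered_input => sz /and3P[lt_n lt_m _] Elt.
apply/andP; split; first by rewrite /= (@size_flatten_map _ _ 2) //; lia.
rewrite /= (leq_ltn_trans _ lt_n) ?(leq_ltn_trans _ lt_m) ?leq_pmull //=.
elim: E Elt {sz lt_m} => //= e E IH Elt.
have /andP[lt1 lt2] := Elt e (mem_head _ _).
rewrite IH ?andbT; last by move=> e' e'E; apply: Elt; rewrite inE e'E orbT.
by apply/andP; split; apply: leq_ltn_trans lt_n; lia.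
Qed.

Lemma reduction_solves (R : realType) (alpha : R) P a b G t :
  alpha < 5%:R / 3%:R ->
  solves_in (Q := n_pairs_min_distance K alpha) P a b (layered_instance G) t ->
  exists2 t', (t' <= t + (35 + 9 * num_vertices G + 50 * num_edges G))%N &
    solves_in (Q := triangle_detection) (reduction P) a (2 * a + b) G t'.
Proof.
move=> lt_alpha [fit halt acc].
pose E := [seq (val e.1, val e.2) | e <- edges G].
have szE : size E = num_edges G by rewrite size_map.
have E_lt (e : nat * nat) :
    e \in E -> (e.1 < num_vertices G)%N && (e.2 < num_vertices G)%N.
  by case/mapP => e' _ -> /=; rewrite !ltn_ord.
have enc :
    encode (p := triangle_detection) G = triangle_input (num_vertices G) E.
  by rewrite /triangle_input szE -map_comp.
have enc' : encode (p := n_pairs_min_distance K alpha) (layered_instance G) =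
    layered_input (num_vertices G) E.
  rewrite /= num_edges_layered encode_layered_edges encode_layered_pairs.
  by rewrite /layered_input szE size_map size_enum_ord.
have := layered_instance_below_five lt_alpha acc.
move: fit halt acc; rewrite enc' /=.
have [n0|n_gt0] := posnP (num_vertices G); last first.
  rewrite -word_length4 // => fit halt _ below.
  have [t' let' [h' reg0]] := reduction_correct fit E_lt n_gt0 halt.
  exists t'; first by rewrite -szE.
  rewrite /solves_in enc; split; rewrite ?fits_triangle_input //.
  by rewrite [accepts _ _ _]/= reg0 -below; case: below_five.
have noedge : E = [::].
  by case: (E) E_lt => // e E' /(_ e (mem_head _ _)); rewrite n0.
have noT : ~ has_triangle G.
  by move=> [u _]; have := leq_ltn_trans (leq0n _) (ltn_ord u); rewrite n0.
(* Without vertices the prologue halts after two steps, with register 0 still zero. *)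
rewrite noedge n0 => /andP[/= sz _] _ _ _; exists 2; first by lia.
rewrite /solves_in enc noedge /= n0.
(* The three cells of the layered input fit into 2 ^ b addresses, so [b] is positive. *)
have w2 : (2 <= 2 ^ word_length a (2 * a + b) 0)%N.
  move: sz; rewrite /word_length trunc_log0 muln0 !add0n.
  case: b => // b _; rewrite addnS expnS.
  by have := expn_gt0 2 (2 * a + b); lia.
split=> //; first by apply/andP; split => //=; rewrite (ltn_trans _ w2).
Qed.

End LayeredInstance.

(** * Transfer of running times between the two problems *)

Section Transfer.
Variable R : realType.

Lemma has_algorithm_le (Q : problem) (D : instance Q -> Prop)
    (sz : instance Q -> nat) (e e' : R) :
  e <= e' -> has_algorithm D sz e -> has_algorithm D sz e'.
Proof.
move=> le_e [P [a [b [tot [C [N H]]]]]]; exists P, a, b; split=> //.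
(* [C] may be negative, and powers grow with the exponent only when the base is at least 1. *)
exists `|C|, (maxn N 1) => x Dx; rewrite geq_max => /andP[leN le1].
have [t let_ sol] := H x Dx leN; exists t => //.
apply: le_trans let_ _.
apply: (@le_trans _ _ (`|C| * (sz x)%:R `^ e)).
  by rewrite ler_wpM2r ?powR_ge0 // ler_norm.
by rewrite ler_wpM2l // ler_powR // ler1n.
Qed.

Variables (K : nat) (K_gt0 : (0 < K)%N) (alpha : R).
Hypothesis lt_alpha : alpha < 5%:R / 3%:R.
Variables (D : graph -> Prop) (sz : graph -> nat).
Variables (D' : pairs_instance K -> Prop) (sz' : pairs_instance K -> nat).
Variables (k c : nat) (e : R).
Hypothesis k_gt0 : (0 < k)%N.
Hypothesis DD' : forall G, D G -> D' (layered_instance K_gt0 G).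
Hypothesis szsz' : forall G, sz' (layered_instance K_gt0 G) = (k * sz G)%N.
Hypothesis overhead : forall G, D G -> (0 < sz G)%N ->
  (35 + 9 * num_vertices G + 50 * num_edges G)%:R <= c%:R * (sz G)%:R `^ e.

(** Serves both bounds: [sz] counts edges with k = 6, or vertices with k = 4. The factor [k]
    contributes k ^ e to the constant, the overhead contributes [c]. *)
Lemma has_algorithm_transfer :
  has_algorithm (Q := n_pairs_min_distance K alpha) D' sz' e ->
  has_algorithm (Q := triangle_detection) D sz e.
Proof.
move=> [P [a [b [tot [C [N H]]]]]]; exists (reduction P), a, (2 * a + b)%N.
split=> [G|].
  have [t sol] := tot (layered_instance K_gt0 G).
  by have [t' _ sol'] := reduction_solves lt_alpha sol; exists t'.
exists (C * k%:R `^ e + c%:R), (maxn N 1) => G DG.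
rewrite geq_max => /andP[leN le1].
have leN' : (N <= sz' (layered_instance K_gt0 G))%N.
  by rewrite szsz' (leq_trans leN) // leq_pmull.
have [t let_ sol] := H _ (DD' DG) leN'.
have [t' let' sol'] := reduction_solves lt_alpha sol; exists t' => //.
apply: (@le_trans _ _ (t%:R + (35 + 9 * num_vertices G + 50 * num_edges G)%:R)).
  by rewrite -natrD ler_nat.
rewrite mulrDl lerD ?overhead //.
by move: let_; rewrite szsz' natrM powRM // mulrA.
Qed.

End Transfer.

Lemma num_vertices_le_edges G :
  no_isolated G -> (num_vertices G <= 2 * num_edges G)%N.
Proof.
move=> iso; pose ends := map fst (edges G) ++ map snd (edges G).
have sub : {subset 'I_(num_vertices G) <= ends}.
  move=> u _; have [v /orP[uv|vu]] := iso u; rewrite mem_cat.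
    by rewrite (map_f fst uv).
  by rewrite (map_f snd vu) orbT.
have : (#|'I_(num_vertices G)| <= #|ends|)%N by apply/subset_leq_card/subsetP.
rewrite card_ord => /leq_trans; apply.
apply: leq_trans (card_size _) _.
by rewrite size_cat !size_map addnn mul2n.
Qed.

Lemma num_edges_le_vertices G : (num_edges G <= num_vertices G ^ 2)%N.
Proof.
have := max_card (mem (edges G)).
by rewrite (card_uniqP (map_uniq (edges_uniq G))) card_prod card_ord mulnn.
Qed.

(** From n <= 2 m and m >= 1, the constant is 35 + 18 + 50 = 103. *)
Lemma overhead_edges (R : realType) (e : R) G : 1 <= e ->
  no_isolated G -> (0 < num_edges G)%N ->
  (35 + 9 * num_vertices G + 50 * num_edges G)%:R
    <= 103%:R * (num_edges G)%:R `^ e.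
Proof.
move=> e1 /num_vertices_le_edges le_nm m0.
apply: (@le_trans _ _ (103 * num_edges G)%:R); first by rewrite ler_nat; lia.
by rewrite natrM ler_wpM2l // le1r_powR // ler1n.
Qed.

(** From m <= n ^ 2 and n >= 1, the constant is 35 + 9 + 50 = 94. *)
Lemma overhead_vertices (R : realType) (e : R) G : 2%:R <= e ->
  (0 < num_vertices G)%N ->
  (35 + 9 * num_vertices G + 50 * num_edges G)%:R
    <= 94%:R * (num_vertices G)%:R `^ e.
Proof.
move=> e2 n0; have le_mn := num_edges_le_vertices G.
apply: (@le_trans _ _ (94 * num_vertices G ^ 2)%:R).
  by rewrite ler_nat; nia.
by rewrite natrM ler_wpM2l // natrX -powR_mulrn // ler_powR // ler1n.
Qed.

Lemma requires_quadratic_time (R : realType) (K : nat) (alpha e : R) :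
  (0 < K)%N -> e < 2%:R ->
  ~ has_algorithm (Q := n_pairs_min_distance K alpha) (fun=> True)
      (fun x => num_vertices (pgraph x)) e.
Proof.
move=> K_gt0 e2 [P [a [b [tot [C [N H]]]]]].
(* On 4 (q + 1) vertices the time is at most A (q + 1) ^ e. This falls below (q + 1) ^ 2 as soon as
   q + 1 exceeds B, the root of A of order 2 - e. *)
pose A := `|C| * 4%:R `^ e; pose B := A `^ (2%:R - e)^-1.
have A0 : 0 <= A by rewrite mulr_ge0 ?powR_ge0.
pose q := maxn N (Num.bound B).
have [//|t let_ sol] := H (bipartite_instance q K_gt0) I _.
  by rewrite /= /q; lia.
have := bipartite_time tot sol; rewrite leqNgt => /negP; apply.
rewrite -(ltr_nat R); apply: le_lt_trans let_ _.
rewrite [num_vertices _]/= natrM powRM // mulrA.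
apply: (@le_lt_trans _ _ (A * q.+1%:R `^ e)).
  by rewrite ler_wpM2r ?powR_ge0 // ler_wpM2r ?powR_ge0 // ler_norm.
have -> : (q.+1 ^ 2)%:R = q.+1%:R `^ (2%:R - e) * q.+1%:R `^ e :> R.
  rewrite -powRD; last by rewrite pnatr_eq0 implybT.
  by rewrite subrK powR_mulrn // natrX.
rewrite ltr_pM2r ?powR_gt0 //.
have -> : A = B `^ (2%:R - e).
  by rewrite -powRrM mulVf ?powRr1 //; lra.
rewrite gt0_ltr_powR ?nnegrE ?powR_ge0 //; first by lra.
apply: lt_le_trans (archi_boundP (powR_ge0 _ _)) _.
by rewrite ler_nat /q -/B leqW ?leq_maxr.
Qed.

Theorem theorem9 (R : realType) :
  (forall delta : R, sparse_triangle_hypothesis delta ->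
     forall (K : nat) (alpha : R), (0 < K)%N -> alpha < 5%:R / 3%:R ->
       @requires_time R (n_pairs_min_distance K alpha)
         (fun x => no_isolated (pgraph x)) (fun x => num_edges (pgraph x))
         (1 + delta)) /\
  (dense_triangle_hypothesis R ->
     forall (K : nat) (alpha : R), (0 < K)%N -> alpha < 5%:R / 3%:R ->
       @requires_time R (n_pairs_min_distance K alpha)
         (fun=> True) (fun x => num_vertices (pgraph x)) (mm_exponent R)).
Proof.
split=> [delta [delta0 hard]|hard] K alpha K_gt0 lt_alpha eps eps0 alg.
  (* Capping [eps] at [delta] keeps the exponent at least 1, where the linear overhead is
     absorbed. *)
  pose eps' := Num.min eps delta.
  have le_eps : eps' <= eps /\ eps' <= delta by rewrite !ge_min !lexx orbT.
  have e1 : 1 <= 1 + delta - eps' by lra.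
  have le_e : 1 + delta - eps <= 1 + delta - eps' by lra.
  apply: (hard eps'); first by rewrite lt_min eps0.
  apply: (has_algorithm_transfer lt_alpha (k := 6) (c := 103)
            (K_gt0 := K_gt0) _ _ _ _ (has_algorithm_le le_e alg)) => //.
  - exact: no_isolated_layered.
  - exact: num_edges_layered.
  - by move=> G; apply: overhead_edges.
(* Below exponent 2 the overhead is not absorbed, but the adversary bound already excludes the
   algorithm. *)
have [e2|e2] := ltP (mm_exponent R - eps) 2%:R.
  exact: requires_quadratic_time K_gt0 e2 alg.
apply: (hard eps eps0).
apply: (has_algorithm_transfer lt_alpha (k := 4) (c := 94)
          (K_gt0 := K_gt0) _ _ _ _ alg) => // G _.
exact: overhead_vertices.
Qed.
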